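(* Let $n>1$ and $m\geqslant 2n-1$ be integers. (i) If $m$ is a prime or a power of two, then $k(k-1)\not\equiv l(l-1)\pmod m$ for all $1\leqslant k<l\leqslant n$. (ii) If $m$ is a power of two with $m\leqslant 2.4n$, then $2k(k-1)\equiv 2l(l-1)\pmod m$ for some $1\leqslant k<l\leqslant n$. *)

(* Defs.v *)
From mathcomp Require Export all_boot all_order all_algebra.

Set Implicit Arguments.
Unset Strict Implicit.
Unset Printing Implicit Defensive.

Definition power_of_two (m : nat) : Prop := exists a : nat, m = 2 ^ a.

(* Main.v *)
(** The difference factors as [l(l-1) - k(k-1) = (l-k)(l+k-1)], where both
    factors are positive, smaller than [2n-1 <= m], and of opposite parity.  A
    prime [m] would divide one of them; a power of two is coprime to the odd
    one, so it would divide the other.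
    For (ii), [m >= 3] forces [m = 4q], and [k = q], [l = q+1] work, since
    [2(q+1)q - 2q(q-1) = 4q]. *)
Require Import Defs.
From mathcomp Require Import all_boot all_order all_algebra.
From mathcomp Require Import zify.

Set Implicit Arguments.
Unset Strict Implicit.
Unset Printing Implicit Defensive.

Lemma pronic_diff (k l : nat) : 0 < k -> k <= l ->
  l * (l - 1) - k * (k - 1) = (l - k) * (l + k - 1).
Proof.
(* With [k] positive and [l] written as [k] plus [d], all truncated subtractions disappear and a
   polynomial identity is left. *)
case: k => // k _ /subnKC <-; set d := l - k.+1.
have -> : k.+1 + d - k.+1 = d by lia.
have -> : k.+1 + d - 1 = k + d by lia.
have -> : k.+1 + d + k.+1 - 1 = k + d + k.+1 by lia.
by rewrite subn1 /=; nia.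
Qed.

Lemma odd_diff_sum_pred (k l : nat) : 0 < k -> k <= l ->
  odd (l + k - 1) = ~~ odd (l - k).
Proof. by move=> k_gt0 le_kl; lia. Qed.

Lemma pow2_Gauss (a x y : nat) : odd x -> 2 ^ a %| x * y -> 2 ^ a %| y.
Proof.
by move=> odd_x; rewrite Gauss_dvdr // coprimeXl // coprime2n.
Qed.

Lemma prime_or_pow2_dvd_factor (m x y : nat) :
  prime m \/ power_of_two m -> odd x != odd y ->
  m %| x * y -> (m %| x) || (m %| y).
Proof.
case=> [pr_m _|[a ->]]; first by rewrite Euclid_dvdM.
case odd_x: (odd x) => odd_y dvd_xy.
  by rewrite (pow2_Gauss odd_x dvd_xy) orbT.
rewrite (@pow2_Gauss a y x) //; first by case: (odd y) odd_y.
by rewrite mulnC.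
Qed.

Lemma pronic_distinct (n m k l : nat) :
  2 * n - 1 <= m -> prime m \/ power_of_two m ->
  1 <= k -> k < l -> l <= n -> k * (k - 1) <> l * (l - 1) %[mod m].
Proof.
(* The congruence is flipped so that the larger product comes first, as subtraction in [nat]
   requires. *)
move=> le_nm m_spec k_gt0 lt_kl le_ln /esym/eqP.
rewrite eqn_mod_dvd; last by apply: leq_mul; lia.
rewrite (pronic_diff k_gt0 (ltnW lt_kl)) => /(prime_or_pow2_dvd_factor m_spec).
rewrite (odd_diff_sum_pred k_gt0 (ltnW lt_kl)) => dvd_factor.
(* Since [k < l <= n], both factors are positive and at most 2n - 2 < m. *)
have /orP[/dvdn_leq|/dvdn_leq] := dvd_factor ltac:(by case: (odd _)).
  by lia.
by lia.
Qed.

Lemma double_pronic_eq_mod (q : nat) :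
  2 * q * (q - 1) = 2 * q.+1 * (q.+1 - 1) %[mod 4 * q].
Proof.
have -> : 2 * q.+1 * (q.+1 - 1) = 2 * q * (q - 1) + 4 * q by case: q => // q; rewrite !subn1 /=; nia.
by rewrite modnDr.
Qed.

(** Holds as 2.4 < 4. For m = 4q it gives q + 1 <= n, which keeps both witnesses of (ii) in
    range. *)
Lemma ratio24_lt (m n : nat) : 0 < n ->
  (m%:R <= 2.4%Q * n%:R :> rat)%R -> m < 4 * n.
Proof.
move=> n_gt0 le_mn; rewrite -(Num.Theory.ltr_nat rat).
apply: (Order.POrderTheory.le_lt_trans le_mn); rewrite GRing.natrM.
by rewrite Num.Theory.ltr_pM2r // Num.Theory.ltr0n.
Qed.

Theorem theorem2p2 (n m : nat) (hn : 1 < n) (hm : 2 * n - 1 <= m) :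
  (prime m \/ power_of_two m ->
     forall k l : nat, 1 <= k -> k < l -> l <= n ->
       k * (k - 1) <> l * (l - 1) %[mod m]) /\
  (power_of_two m -> (m%:R <= 2.4%Q * n%:R :> rat)%R ->
     exists k l : nat, [/\ 1 <= k, k < l, l <= n &
       2 * k * (k - 1) = 2 * l * (l - 1) %[mod m]]).
Proof.
split=> [m_spec k l|[a m_def] /(ratio24_lt (ltnW hn)) lt_mn].
  exact: pronic_distinct hm m_spec.
(* The exponents 0 and 1 give m < 3 <= 2n - 1. *)
case: a m_def => [|[|b]] m_def; [by lia | by lia |].
have {}m_def : m = 4 * 2 ^ b by rewrite m_def !expnS mulnA.
exists (2 ^ b), (2 ^ b).+1; rewrite m_def expn_gt0 ltnSn.
by split=> //; [lia | exact: double_pronic_eq_mod].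
Qed.
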